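(* Let $n=3$ and let $A=\mathrm{diag}(d,d,d)$, where $d$ is an integer with $|d|>1$. Identify $K_0(C(\mathbb T^3))$ with $\bigwedge^{\mathrm{even}}_{\mathbb Z}\{e_1,e_2,e_3\}=\bigwedge^0_{\mathbb Z}\{e_1,e_2,e_3\}\oplus\bigwedge^2_{\mathbb Z}\{e_1,e_2,e_3\}$. Then, given any element $[q+c_1e_1\wedge e_2+c_2e_1\wedge e_3+c_3e_2\wedge e_3]\in K_0(C(\mathbb T^3))^+$ with $q\in\mathbb N$ (a positive integer) and $c_1,c_2,c_3\in\mathbb Z$, there exists a finitely generated projective $C(\mathbb T^3)$-submodule $V_0'\subseteq\Xi$ whose class in $K_0(C(\mathbb T^3))$ is $$[V_0']=[q+c_1e_1\wedge e_2+c_2e_1\wedge e_3+c_3e_2\wedge e_3]$$ and such that $D(V_0')\supseteq V_0'$. Hence, setting $V_m'=D^m(V_0')$ for $m\ge 0$, the nested sequence $\{V_m'\}$ gives a projective multiresolution analysis corresponding to the dilation matrix $A$.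
   Context: Write $e(r)=e^{2\pi i r}$. Functions in $C(\mathbb T^3)$ are identified with continuous $\mathbb Z^3$-periodic functions on $\mathbb R^3$. $\Xi$ is the right Hilbert $C(\mathbb T^3)$-module obtained by completing $C_c(\mathbb R^3)$ with respect to the norm $\|\xi\|=\|\langle\xi,\xi\rangle_{C(\mathbb T^3)}\|_\infty^{1/2}$ determined by $\langle \xi,\eta\rangle_{C(\mathbb T^3)}(t)=\sum_{p\in\mathbb Z^3}(\overline{\xi}\eta)(t-p)$, with $C(\mathbb T^3)$ acting by pointwise multiplication; its elements are continuous functions on $\mathbb R^3$ and $\Xi\subseteq L^2(\mathbb R^3)$. $D=\mathcal F D_A\mathcal F^{*}$, where $D_A(\zeta)(x)=|\det A|^{1/2}\zeta(Ax)$ on $L^2(\mathbb R^3)$ and $\mathcal F(f)(x)=\int_{\mathbb R^3}f(t)e(-t\cdot x)\,dt$; explicitly $(D\xi)(x)=|\det A|^{-1/2}\xi((A^t)^{-1}x)$. Identification of $K_0$: the Chern character is integral on tori and gives an isomorphism $K_0(C(\mathbb T^3))\cong \check H^{\mathrm{even}}(\mathbb T^3,\mathbb Z)\cong\bigwedge^{\mathrm{even}}_{\mathbb Z}\{e_1,e_2,e_3\}$, sending a finitely generated projective module (vector bundle) to its rank plus its first Chern class, where $\check H^k(\mathbb T^3,\mathbb Z)\cong\bigwedge^k_{\mathbb Z}\{e_1,e_2,e_3\}$. Its normalization is such that the module of continuous $f:\mathbb R^3\to\mathbb C$, $1$-periodic in $s_1,s_2$, with $f(s_1,s_2,t-q)=e(a_1s_1+a_2s_2)f(s_1,s_2,t)$,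 corresponds to $q-a_1e_1\wedge e_3-a_2e_2\wedge e_3$. $K_0(C(\mathbb T^3))^+$ is the positive cone, i.e. the set of classes of finitely generated projective modules; each of its nonzero elements has the form $q+c_1e_1\wedge e_2+c_2e_1\wedge e_3+c_3e_2\wedge e_3$ with $q\in\mathbb N$, $c_i\in\mathbb Z$. A sequence $\{V_j\}_{j\in\mathbb Z}$ of subspaces of $\Xi$ is a projective multiresolution analysis for dilation by $A$ if: (i) $V_0$ is a finitely generated projective $C(\mathbb T^3)$-submodule of $\Xi$; (ii) $V_j=D^j(V_0)$ for all $j$; (iii) $V_j\subset V_{j+1}$ for all $j\in\mathbb Z$; (iv) $\bigcup_{j\ge0}V_j$ is dense in $\Xi$ in the Hilbert $C(\mathbb T^3)$-module norm; (v) $\bigcap_{j\in\mathbb Z}V_j=\{0\}$. A sequence given only for $j\ge0$ is extended to negative $j$ by $V_j=D^j(V_0)$. *)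

(* Defs.v *)
From HB Require Import structures.
From mathcomp Require Import all_boot all_order all_algebra.
From mathcomp Require Import all_classical all_reals all_analysis.
From mathcomp Require Import complex.

Set Implicit Arguments.
Unset Strict Implicit.
Unset Printing Implicit Defensive.

Import Order.TTheory GRing.Theory Num.Theory.
Import numFieldNormedType.Exports.

Local Open Scope classical_set_scope.
Local Open Scope ring_scope.

Section Submodules.
Variables (A : nzRingType) (M : lmodType A).

Record submodule := Submodule {
  submodule_set :> set M;
  submodule0 : submodule_set 0;
  submoduleD : forall u v,
    submodule_set u -> submodule_set v -> submodule_set (u + v);
  submoduleZ : forall a u, submodule_set u -> submodule_set (a *: u) }.

Definition submodule_pred (V : submodule) : {pred M} := fun u => `[< submodule_set V u >].

Lemma submodule_predP (V : submodule) : submod_closed (submodule_pred V).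
Proof.
split; first exact/asboolP/submodule0.
move=> a u v /asboolP Vu /asboolP Vv; apply/asboolP.
by apply: submoduleD => //; apply: submoduleZ.
Qed.

HB.instance Definition _ (V : submodule) :=
  GRing.isSubmodClosed.Build A M (submodule_pred V) (submodule_predP V).

Record submodule_type (V : submodule) := SubmoduleType {
  submodule_val : M;
  submodule_valP : submodule_val \in submodule_pred V }.

HB.instance Definition _ (V : submodule) :=
  [isSub for @submodule_val V].
HB.instance Definition _ (V : submodule) :=
  [Choice of submodule_type V by <:].
HB.instance Definition _ (V : submodule) :=
  [SubChoice_isSubLmodule of submodule_type V by <:].

End Submodules.

Section KTheory.
Variable A : nzRingType.

Definition module_iso (M N : lmodType A) : Prop :=
  exists f : {linear M -> N}, bijective f.

Definition fg_projective (M : lmodType A) : Prop :=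
  exists n (i : {linear M -> 'rV[A]_n}) (r : {linear 'rV[A]_n -> M}),
    cancel i r.

(* Equality of the classes [M] and [N] in the Grothendieck group of the monoid
   of isomorphism classes of finitely generated projective modules. *)
Definition K0_eq (M N : lmodType A) : Prop :=
  [/\ fg_projective M, fg_projective N &
  exists P : lmodType A,
    fg_projective P /\ module_iso (M * P)%type (N * P)%type].

End KTheory.

(* R[i] itself has no canonical topology; it gets one through its
   numClosedFieldType structure. *)
Definition Cplx (R : realType) : numClosedFieldType := R[i].

Section Torus.
Variable R : realType.
Local Notation C := (Cplx R).
Local Notation R3 := 'cV[R]_3.
Local Notation Z3 := 'cV[int]_3.

Definition lattice (p : Z3) : R3 := map_mx intr p.

Definition e_ (r : R) : C := (cos (2 * pi * r) +i* sin (2 * pi * r))%C.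

Definition torus_pred : {pred R3 -> C} := fun f =>
  `[< continuous f /\ forall (p : Z3) t, f (t - lattice p) = f t >].

Lemma torus_predP : subring_closed torus_pred.
Proof.
split.
- by apply/asboolP; split => //; apply: cst_continuous.
- move=> f g /asboolP[cf pf] /asboolP[cg pg]; apply/asboolP; split.
    by move=> x; apply: (@continuousB _ _ _ f g x); [exact: cf | exact: cg].
  by move=> p t; rewrite -[LHS]/(f _ - g _) pf pg.
- move=> f g /asboolP[cf pf] /asboolP[cg pg]; apply/asboolP; split.
    by move=> x; apply: (@continuousM _ _ f g x); [exact: cf | exact: cg].
  by move=> p t; rewrite -[LHS]/(f _ * g _) pf pg.
Qed.

HB.instance Definition _ :=
  GRing.isSubringClosed.Build (R3 -> C) torus_pred torus_predP.

Record CT3 := MkCT3 { CT3_val :> R3 -> C; CT3_valP : CT3_val \in torus_pred }.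

HB.instance Definition _ := [isSub for CT3_val].
HB.instance Definition _ := [Choice of CT3 by <:].
HB.instance Definition _ := [SubChoice_isSubComNzRing of CT3 by <:].

(* W-valued functions on R^3, with C(T^3) acting by pointwise multiplication. *)
Definition funmod (W : lmodType C) := R3 -> W.

Section Funmod.
Variable W : lmodType C.

HB.instance Definition _ := GRing.Zmodule.copy (funmod W) (R3 -> W).

Definition funmod_scale (a : CT3) (F : funmod W) : funmod W :=
  fun t => a t *: F t.

Fact funmod_scaleA a b F :
  funmod_scale a (funmod_scale b F) = funmod_scale (a * b) F.
Proof. by apply/funext => t; rewrite /funmod_scale scalerA. Qed.
Fact funmod_scale1 : left_id 1 funmod_scale.
Proof. by move=> F; apply/funext => t; rewrite /funmod_scale scale1r. Qed.
Fact funmod_scaleDr : right_distributive funmod_scale +%R.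
Proof. by move=> a F G; apply/funext => t; rewrite /funmod_scale scalerDr. Qed.
Fact funmod_scaleDl F : {morph funmod_scale^~ F : a b / a + b}.
Proof. by move=> a b; apply/funext => t; rewrite /funmod_scale scalerDl. Qed.

HB.instance Definition _ := GRing.Zmodule_isLmodule.Build CT3 (funmod W)
  funmod_scaleA funmod_scale1 funmod_scaleDr funmod_scaleDl.
End Funmod.

(* Xi lives inside this module. *)
Definition scalar_functions : lmodType CT3 := funmod (C^o).

Definition sqabs (z : C) : R := complex.Re z ^+ 2 + complex.Im z ^+ 2.

Definition inner_diag (xi : R3 -> C) (t : R3) : \bar R :=
  (\esum_(p in [set: Z3]) (sqabs (xi (t - lattice p)))%:E)%E.

(* Defined on all functions, possibly +oo. *)
Definition Xi_norm (xi : R3 -> C) : \bar R :=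
  sqrte (ereal_sup (range (inner_diag xi))).

Definition Cc (xi : R3 -> C) : Prop :=
  continuous xi /\ compact (closure [set x | xi x != 0]).

(* Since Xi_norm dominates the sup norm, the completion of C_c(R^3) is realised
   by functions, as the closure of C_c(R^3). *)
Definition Xi : set (R3 -> C) := [set xi | continuous xi /\
  forall eps : R, 0 < eps ->
    exists2 eta, Cc eta & (Xi_norm (xi - eta)%R < eps%:E)%E].

Definition dilation (A : 'M[int]_3) (xi : R3 -> C) : R3 -> C :=
  let B : 'M[R]_3 := map_mx intr A in
  fun x => ((Num.sqrt `|\det B|)^-1)%:C%C * xi (invmx B^T *m x).

(* D^j(V) for j in Z.  D is bijective when det A != 0, so that taking preimages
   under D is applying D^{-1}. *)
Definition dilation_pow (A : 'M[int]_3) (j : int) (V : set (R3 -> C)) :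
    set (R3 -> C) :=
  match j with
  | Posz n => iter n (fun W => dilation A @` W) V
  | Negz n => iter n.+1 (fun W => dilation A @^-1` W) V
  end.

Definition subspace (V : set (R3 -> C)) : Prop :=
  [/\ V 0, (forall u v, V u -> V v -> V (u + v))
    & (forall (c : C) u, V u -> V (fun t => c * u t))].

Record is_PMRA (A : 'M[int]_3) (V : int -> set (R3 -> C)) : Prop := IsPMRA {
  pmra_sub : forall j, V j `<=` Xi /\ subspace (V j);
  pmra_proj : exists V0 : submodule scalar_functions,
    V 0 = V0 /\ fg_projective (submodule_type V0);
  pmra_dil : forall j, V j = dilation_pow A j (V 0);
  pmra_nested : forall j, V j `<=` V (j + 1);
  pmra_dense : forall xi, Xi xi -> forall eps : R, 0 < eps ->
    exists (n : nat) eta, V n eta /\ (Xi_norm (xi - eta)%R < eps%:E)%E;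
  pmra_cap : \bigcap_(j in [set: int]) V j = [set 0] }.

(* Every complex vector bundle on T^3 = R^3/Z^3 becomes trivial on R^3, hence is
   given by such a cocycle; its sections are the continuous F : R^3 -> C^q with
   F(t - m) = g_m(t) F(t). *)
Record automorphy_factor (q : nat) := AutomorphyFactor {
  af_fun :> Z3 -> R3 -> 'M[C]_q;
  af_continuous : forall m i j, continuous (fun t => af_fun m t i j);
  af_unit : forall m t, af_fun m t \in unitmx;
  af_cocycle : forall m n t,
    af_fun (m + n) t = af_fun m (t - lattice n) *m af_fun n t }.

Section Sections.
Variables (q : nat) (g : automorphy_factor q).

Definition sections_set : set (funmod 'cV[C]_q) := [set F : R3 -> 'cV[C]_q |
  (forall i, continuous (fun t => F t i 0)) /\
  (forall m t, F (t - lattice m) = g m t *m F t)].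

Fact sections0 : sections_set 0.
Proof.
split=> [i|m t].
  have -> : (fun t => (0 : funmod 'cV[C]_q) t i 0) = cst 0.
    by apply/funext => t; rewrite mxE.
  exact: cst_continuous.
by rewrite -[RHS]/(g m t *m 0) mulmx0.
Qed.

Fact sectionsD F G :
  sections_set F -> sections_set G -> sections_set (F + G).
Proof.
move=> [cF eF] [cG eG]; split=> [i|m t].
  have -> : (fun t => (F + G) t i 0) =
      (fun t => F t i 0) + (fun t => G t i 0).
    by apply/funext => t; rewrite mxE.
  by move=> x; apply: continuousD; [exact: cF | exact: cG].
by rewrite -[LHS]/(F _ + G _) eF eG -[RHS]/(g m t *m (F t + G t)) mulmxDr.
Qed.

Fact sectionsZ (a : CT3) F : sections_set F -> sections_set (a *: F).
Proof.
move=> [cF eF]; have /asboolP[ca pa] := CT3_valP a.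
split=> [i|m t].
  have -> : (fun t => (a *: F) t i 0) = (a : R3 -> C) * (fun t => F t i 0).
    by apply/funext => t; rewrite mxE.
  by move=> x; apply: continuousM; [exact: ca | exact: cF].
by rewrite -[LHS]/(a _ *: F _) eF pa -[RHS]/(g m t *m (a t *: F t)) -scalemxAr.
Qed.

Definition sections : submodule (funmod 'cV[C]_q) :=
  Submodule sections0 sectionsD sectionsZ.

Definition unitZ (i : 'I_3) : Z3 := delta_mx i 0.

(* The first Chern class is the image of det g under the connecting map
   H^1(Z^3, C(R^3, C^* )) -> H^2(Z^3, Z) = /\^2 Z^3 of the exponential sequence:
   for continuous logarithms h_i of det g_{e_i} and
     n(m, m') = h_m(t - m') + h_{m'}(t) - h_{m+m'}(t),
   its coefficient on e_i /\ e_j is n(e_j, e_i) - n(e_i, e_j).  This choice of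
   sign gives c_1 = - a1 e_1 /\ e_3 - a2 e_2 /\ e_3 for the functions with
   f(s1, s2, t - q) = e(a1 s1 + a2 s2) f(s1, s2, t). *)
Definition first_chern_class (c : 'M[int]_3) : Prop :=
  exists h : 'I_3 -> R3 -> R,
    [/\ forall i, continuous (h i),
        forall i t, \det (g (unitZ i) t) =
          (Num.sqrt (sqabs (\det (g (unitZ i) t))))%:C%C * e_ (h i t)
      & forall i j t, (c i j)%:~R =
          (h j (t - lattice (unitZ i)) - h j t) -
          (h i (t - lattice (unitZ j)) - h i t)].

End Sections.

(* /\^even Z^3 = Z + /\^2 Z^3, the second summand being the alternating integer
   matrices, e_i /\ e_j = e_i (x) e_j - e_j (x) e_i. *)
Definition ext_even := (int * 'M[int]_3)%type.

Definition wedge (i j : 'I_3) : 'M[int]_3 := delta_mx i j - delta_mx j i.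

(* q + c1 e_1 /\ e_2 + c2 e_1 /\ e_3 + c3 e_2 /\ e_3 *)
Definition ext_elt (q : nat) (c1 c2 c3 : int) : ext_even :=
  (q%:Z, c1 *: wedge (inord 0) (inord 1) + c2 *: wedge (inord 0) (inord 2)
       + c3 *: wedge (inord 1) (inord 2)).

Definition chern_character q (g : automorphy_factor q) (x : ext_even) : Prop :=
  x.1 = q%:Z /\ first_chern_class g x.2.

(* [M] = x in K_0(C(T^3)), identified with /\^even Z^3 by the Chern character. *)
Definition K0_class (M : lmodType CT3) (x : ext_even) : Prop :=
  exists q (g : automorphy_factor q),
    K0_eq M (submodule_type (sections g)) /\ chern_character g x.

Definition K0_positive (x : ext_even) : Prop :=
  exists M : lmodType CT3, fg_projective M /\ K0_class M x.

End Torus.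

(* Main.v *)
(** Let [w = (q, 1, 1)] and let [window] be a tent function which is nonzero
    exactly where [|t_i| < 2/3 w_i] for all [i]. Every class is realised by a sum
    [L + 1 + ... + 1] ([q] summands) where the line bundle [L] has automorphy
    factor [e(m^T B t)], with [B] the strictly lower triangular part of the
    Chern matrix [c], so that [B - B^T = c] and [L] is trivial along [e_1]. Send a
    section [F] of this bundle to the compactly supported function
    [window t * sum_k e(k t_1 / q) F_k t], and let [V_0] be the image. Orthogonality
    of the characters of [Z/q] makes this map injective, and shows that [V_0]
    contains every continuous function supported in the box [|t_i| <= 1/3 w_i].
    As the functions in [V_0] are supported in the box twice as large, and
    [|d| >= 2], this gives [V_0 <= D V_0] as well as the density of the union and
    the triviality of the intersection. *)

Require Import Defs.
From HB Require Import structures.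
From mathcomp Require Import all_boot all_order all_algebra.
From mathcomp Require Import all_classical all_reals all_analysis.
From mathcomp Require Import complex finmap.
From mathcomp Require Import ring lra zify.

Import Order.TTheory GRing.Theory Num.Theory.
Import numFieldNormedType.Exports.

Local Open Scope classical_set_scope.
Local Open Scope ring_scope.

Set Implicit Arguments.
Unset Strict Implicit.
Unset Printing Implicit Defensive.

(** * Continuity of scalar functions on a topological space *)

Section Continuity.
Variables (T : topologicalType) (K : numFieldType).
Implicit Types (f g : T -> K).

Lemma continuous_add f g :
  continuous f -> continuous g -> continuous (fun x => f x + g x).
Proof. by move=> cf cg x; apply: (@continuousD _ _ _ f g x); [exact: cf | exact: cg]. Qed.

Lemma continuous_mul f g :
  continuous f -> continuous g -> continuous (fun x => f x * g x).
Proof. by move=> cf cg x; apply: (@continuousM _ _ f g x); [exact: cf | exact: cg]. Qed.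

Lemma continuous_inv f :
  (forall x, f x != 0) -> continuous f -> continuous (fun x => (f x)^-1).
Proof. by move=> f0 cf x; apply: (@continuousV _ _ f x); [exact: f0 | exact: cf]. Qed.

Lemma continuous_compose (U V : topologicalType) (u : T -> U) (v : U -> V) :
  continuous u -> continuous v -> continuous (fun x => v (u x)).
Proof. by move=> cu cv x; apply: (@continuous_comp _ _ _ u v x); [exact: cu | exact: cv]. Qed.

Lemma continuous_const (U : topologicalType) (c : U) : continuous (fun _ : T => c).
Proof. exact: cst_continuous. Qed.

Lemma continuous_sum (I : Type) (r : seq I) (P : pred I) (F : I -> T -> K) :
  (forall i, P i -> continuous (F i)) ->
  continuous (fun x => \sum_(i <- r | P i) F i x).
Proof.
move=> cF; elim: r => [|i r IHr].
  rewrite (_ : (fun x => _) = fun=> 0); first exact: continuous_const.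
  by apply/funext => x; rewrite big_nil.
case: (boolP (P i)) => Pi; last first.
  rewrite (_ : (fun x => _) = fun x => \sum_(j <- r | P j) F j x) //.
  by apply/funext => x; rewrite big_cons (negbTE Pi).
rewrite (_ : (fun x => _) = fun x => F i x + (\sum_(j <- r | P j) F j x)).
  exact: continuous_add (cF i Pi) IHr.
by apply/funext => x; rewrite big_cons Pi.
Qed.

Lemma continuous_prod (I : Type) (r : seq I) (P : pred I) (F : I -> T -> K) :
  (forall i, P i -> continuous (F i)) ->
  continuous (fun x => \prod_(i <- r | P i) F i x).
Proof.
move=> cF; elim: r => [|i r IHr].
  rewrite (_ : (fun x => _) = fun=> 1); first exact: continuous_const.
  by apply/funext => x; rewrite big_nil.
case: (boolP (P i)) => Pi; last first.
  rewrite (_ : (fun x => _) = fun x => \prod_(j <- r | P j) F j x) //.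
  by apply/funext => x; rewrite big_cons (negbTE Pi).
rewrite (_ : (fun x => _) = fun x => F i x * (\prod_(j <- r | P j) F j x)).
  exact: continuous_mul (cF i Pi) IHr.
by apply/funext => x; rewrite big_cons Pi.
Qed.

End Continuity.

(** * The character [e_] and sums of roots of unity *)

Section ComplexExponential.
Variable R : realType.
Local Notation C := (Cplx R).
Implicit Types (x y : R) (z : C).

Definition rc x : C := (x%:C)%C.

Lemma rcB x y : rc (x - y) = rc x - rc y.
Proof. exact: rmorphB. Qed.
Lemma rc_eq0 x : (rc x == 0) = (x == 0).
Proof. exact: fmorph_eq0. Qed.
Lemma rc_norm x : `|rc x| = rc `|x|.
Proof. by rewrite [LHS]normc_def /= expr0n addr0 sqrtr_sqr. Qed.
Lemma rc_lt x y : (rc x < rc y) = (x < y).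
Proof. exact: ltcR. Qed.

Lemma rc_continuous : continuous rc.
Proof.
move=> x; apply/cvgrPdist_lt => e e0.
(* A positive element of [C] is real, so the complex radius [e] comes from [R]. *)
have eE : e = rc (complex.Re e).
  by rewrite /rc RRe_real // ger0_real // ltW.
near=> y; rewrite -rcB rc_norm eE rc_lt.
near: y; apply: (@cvgr_dist_lt _ _ _ _ _ id) => //.
by rewrite -rc_lt -eE.
Unshelve. all: by end_near. Qed.

Lemma e_E x : e_ x = rc (cos (2 * pi * x)) + 'i%C * rc (sin (2 * pi * x)) :> C.
Proof. exact: complexE. Qed.

Lemma e_continuous : continuous (@e_ R : R -> C).
Proof.
have lin : continuous (fun x : R => 2 * pi * x) by exact: mulrl_continuous.
move=> x; rewrite (_ : @e_ R = fun x => rc (cos (2 * pi * x)) +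
  ('i%C : C) * rc (sin (2 * pi * x))); last exact/funext/e_E.
apply: cvgD; last apply: cvgMl_tmp.
- apply: (@continuous_comp _ _ _ (fun x : R => cos (2 * pi * x)) rc).
    by apply: (@continuous_comp _ _ _ ( *%R (2 * pi)) cos);
      [exact: lin | exact: continuous_cos].
  exact: rc_continuous.
- apply: (@continuous_comp _ _ _ (fun x : R => sin (2 * pi * x)) rc).
    by apply: (@continuous_comp _ _ _ ( *%R (2 * pi)) sin);
      [exact: lin | exact: continuous_sin].
  exact: rc_continuous.
Qed.

Lemma e_D x y : e_ (x + y) = e_ x * e_ y :> C.
Proof.
rewrite /e_ mulrDr; set a := _ * x; set b := _ * y.
transitivity (Complex (cos a * cos b - sin a * sin b)
  (cos a * sin b + sin a * cos b)) => //.
by rewrite cosD sinD [X in Complex _ X]addrC.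
Qed.

Lemma e_0 : e_ 0 = 1 :> C.
Proof. by rewrite /e_ mulr0 cos0 sin0. Qed.

Lemma e_neq0 x : e_ x != 0 :> C.
Proof.
apply/eqP => e0; have := e_0; rewrite -(subrr x) e_D e0 mul0r.
by move/esym/eqP; rewrite oner_eq0.
Qed.

Lemma e_N x : e_ (- x) = (e_ x)^-1 :> C.
Proof. by apply: (mulIf (e_neq0 x)); rewrite -e_D addNr e_0 mulVf ?e_neq0. Qed.

Lemma sqabs_e x : sqabs (e_ x) = 1.
Proof. by rewrite /sqabs /e_ /= cos2Dsin2. Qed.

Lemma norm_e x : `|e_ x : C| = 1.
Proof. by rewrite [LHS]normc_def /= cos2Dsin2 sqrtr1. Qed.

Lemma e_1 : e_ 1 = 1 :> C.
Proof. by rewrite /e_ mulr1 mulr_natl cos2pi sin2pi. Qed.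

Lemma e_Mn x n : e_ (x *+ n) = e_ x ^+ n :> C.
Proof. by elim: n => [|n IH]; rewrite ?mulr0n ?e_0 ?expr0 // mulrS e_D IH exprS. Qed.

Lemma e_int (m : int) : e_ (m%:~R) = 1 :> C.
Proof.
case: m => n; first by rewrite -pmulrn e_Mn e_1 expr1n.
by rewrite NegzE mulrNz e_N -pmulrn e_Mn e_1 expr1n invr1.
Qed.

(** The real part of [e_ x] is [1 - 2 sin^2 (pi x)], and [sin (pi |x|)] is positive in this
    range. *)
Lemma e_neq1 x : 0 < `|x| < 1 -> e_ x != 1 :> C.
Proof.
move=> x01; apply/eqP => /(congr1 (@complex.Re R)) /=.
have -> : 2 * pi * x = (pi * x) *+ 2 by rewrite -mulrA mulr_natl.
rewrite cos_mulr2n => c1.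
have : 0 < sin (pi * `|x|).
  apply: sin_gt0_pi; case/andP: x01 => x0 x1.
  by rewrite mulr_gt0 ?pi_gt0 //= gtr_pMr ?pi_gt0.
have : sin (pi * `|x|) ^+ 2 = sin (pi * x) ^+ 2.
  by case: ger0P => _ //; rewrite mulrN sinN sqrrN.
have := cos2Dsin2 (pi * x); move: c1; rewrite -mulr_natl /=.
set c := cos _ ^+ 2 => c1 cs ss s0.
have : sin (pi * `|x|) ^+ 2 = 0.
  by rewrite ss; lra.
by move=> /eqP; rewrite expf_eq0 /= gt_eqF.
Qed.

(** A geometric sum whose ratio [w] satisfies [w^q = 1] and, as [0 < |r / q| < 1], also [w != 1]. *)
Lemma sum_e_eq0 (q : nat) (r : int) : r != 0 -> (`|r| < q)%N ->
  \sum_(k < q) e_ ((r * k)%:~R / q%:R) = 0 :> C.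
Proof.
move=> r0 rq; have q0 : q%:R != 0 :> R by rewrite pnatr_eq0; lia.
set w : C := e_ (r%:~R / q%:R).
have wE (k : nat) : e_ ((r * k)%:~R / q%:R) = w ^+ k :> C.
  by rewrite -e_Mn -[(_ / _) *+ k]mulr_natr intrM -pmulrn mulrAC.
rewrite (eq_bigr (fun k : 'I_q => w ^+ k)) => [|k _]; last exact: wE.
have w1 : w != 1.
  apply: e_neq1; rewrite normr_gt0 mulf_neq0 ?invr_eq0 ?intr_eq0 //= normrM normfV.
  rewrite -intr_norm normr_nat ltr_pdivrMr ?mul1r; last by rewrite ltr0n; lia.
  by rewrite pmulrn ltr_int; lia.
apply: (mulfI (x := w - 1)); first by rewrite subr_eq0.
by rewrite mulr0 -subrX1 -e_Mn -[_ *+ _]mulr_natr divfK // e_int subrr.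
Qed.

Lemma conjC_e x : (e_ x)^* = (e_ x)^-1 :> C.
Proof.
apply: (mulfI (e_neq0 x)); rewrite mulfV ?e_neq0 //.
by rewrite -normCK norm_e expr1n.
Qed.

Lemma conjC_continuous : continuous (fun z : C => z^*).
Proof.
move=> z; apply/(@cvgrPdist_lt _ C _ (nbhs z) (nbhs_filter z)) => e e0.
near=> y; rewrite -rmorphB norm_conjC.
near: y; exists e => //.
Unshelve. all: by end_near. Qed.

End ComplexExponential.

(** * Quasi-periodic functions on R^3 and periodization *)

Section Periodization.
Variable R : realType.
Local Notation C := (Cplx R).
Local Notation R3 := 'cV[R]_3.
Local Notation Z3 := 'cV[int]_3.
Implicit Types (B : 'M[int]_3) (m n : Z3) (s t : R3).

Lemma lattice_0 : lattice R 0 = 0.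
Proof. by apply/matrixP => i j; rewrite !mxE. Qed.

Lemma lattice_D m n : lattice R (m + n) = lattice R m + lattice R n.
Proof. by apply/matrixP => i j; rewrite !mxE intrD. Qed.

Definition phase B m t : R := (map_mx intr (m^T *m B) *m t) 0 0.

Definition expphase B m t : C := e_ (phase B m t).

Lemma phase_continuous B m : continuous (phase B m).
Proof.
rewrite (_ : phase B m = fun t =>
  \sum_j (map_mx intr (m^T *m B) : 'rV[R]_3) 0 j * t j 0); last first.
  by apply/funext => t; rewrite /phase mxE.
apply: continuous_sum => j _.
apply: continuous_mul; [exact: continuous_const | exact: coord_continuous].
Qed.

Lemma expphase_continuous B m : continuous (expphase B m).
Proof.
exact: continuous_compose (@phase_continuous B m) (@e_continuous R).
Qed.

Lemma expphase_neq0 B m t : expphase B m t != 0.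
Proof. exact: e_neq0. Qed.

Lemma expphaseDl B m n t : expphase B (m + n) t = expphase B m t * expphase B n t.
Proof.
rewrite /expphase -e_D /phase (_ : (m + n)^T = m^T + n^T); last first.
  by apply/matrixP => i j; rewrite !mxE.
by rewrite mulmxDl map_mxD mulmxDl mxE.
Qed.

(** The exponent changes by the integer [m^T B n]. Together with additivity in [m] this yields the
    cocycle identity. *)
Lemma expphase_lattice B m n t : expphase B m (t - lattice R n) = expphase B m t.
Proof.
have latE : phase B m (lattice R n) = ((m^T *m B *m n) 0 0)%:~R.
  by rewrite /phase -map_mxM mxE.
rewrite /expphase (_ : phase B m _ = phase B m t - phase B m (lattice R n)).
  by rewrite e_D latE e_N e_int invr1 mulr1.
by rewrite /phase mulmxBr !mxE.
Qed.

Lemma expphase0 m t : expphase 0 m t = 1.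
Proof. by rewrite /expphase /phase mulmx0 map_mx0 mul0mx mxE e_0. Qed.

Definition bounded_support (u : R3 -> C) := exists K : R, forall t, K < `|t| -> u t = 0.

Definition Zbox (k : nat) : set Z3 := [set m : Z3 | forall i, (`|m i 0%R| <= k)%N].

Lemma finite_Zbox k : finite_set (Zbox k).
Proof.
pose f (h : {ffun 'I_3 -> 'I_(k.*2.+1)}) : Z3 := \col_i ((h i : nat)%:Z - k%:Z).
apply: (@sub_finite_set _ _ (f @` setT)); last exact/finite_image/finite_finset.
move=> m mk; exists [ffun i => inord (absz (m i 0 + k%:Z))] => //.
apply/matrixP => i j; rewrite (ord1 j) mxE ffunE inordK; last by have := mk i; lia.
by have := mk i; lia.
Qed.

Lemma norm_coord t i : `|t i 0| <= `|t|.
Proof.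
rewrite [leRHS]/Num.norm /= mx_normrE; apply/bigmax_geP; right => /=.
by exists (i, 0).
Qed.

Lemma norm_le_coord t (K : R) : 0 <= K -> (forall i, `|t i 0| <= K) -> `|t| <= K.
Proof.
move=> K0 tK; rewrite [leLHS]/Num.norm /= mx_normrE; apply/bigmax_leP; split => //=.
by move=> [i j] _; rewrite (ord1 j) /=; exact: tK.
Qed.

(** Dividing by the factor inside the sum makes the result transform by [expphase B]. A sum over an
    infinite set has value 0 by default when infinitely many terms are nonzero, so this is meant for
    [u] of bounded support. *)
Definition periodize B (u : R3 -> C) t : C :=
  \sum_(m \in [set: Z3]) (expphase B m t)^-1 * u (t - lattice R m).

(** If [|m_i| > k] for some [i], then [|t_i - m_i| > K] and the term vanishes. The box depends on
    [t] only through the bound [M]. *)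
Lemma periodize_box B u (K M : R) (k : nat) t :
  (forall s, K < `|s| -> u s = 0) -> `|t| <= M -> M + K <= k%:R ->
  periodize B u t =
  \sum_(m <- fset_set (Zbox k)) (expphase B m t)^-1 * u (t - lattice R m).
Proof.
move=> uK tM Mk; rewrite -fsbig_finite; last exact: finite_Zbox.
apply/esym/fsbig_widen => // m [_ /=] /existsNP[i /negP]; rewrite -ltnNge => ki.
rewrite uK ?mulr0 //; have := norm_coord (t - lattice R m) i.
rewrite !mxE; apply: lt_le_trans; have := norm_coord t i.
have : (k.+1%:R : R) <= `|(m i 0)%:~R|.
  by rewrite -intr_norm -abszE -pmulrn ler_nat.
have := ler_distD (t i 0) (m i 0)%:~R 0; rewrite !subr0 distrC -natr1; lra.
Qed.

Lemma translate_coord m t i : (t - lattice R m) i 0 = t i 0 - (m i 0)%:~R.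
Proof. by rewrite !mxE. Qed.

Lemma translate_continuous m : continuous (fun t => t - lattice R m).
Proof.
move=> t; apply: (@continuousB _ _ _ (fun t => t) (fun=> lattice R m) t).
  exact: cvg_id.
exact: cst_continuous.
Qed.

Lemma periodize_continuous B u :
  continuous u -> bounded_support u -> continuous (periodize B u).
Proof.
move=> cu [K uK] t0.
(* One box serves the whole unit ball about [t0], so there the series is a finite sum of continuous
   functions. *)
pose k := Num.truncn (Num.max 0 (`|t0| + 1 + K)); pose S := fset_set (Zbox k.+1).
pose v t := \sum_(m <- S) (expphase B m t)^-1 * u (t - lattice R m).
have vE : {near t0, v =1 periodize B u}.
  near=> t; apply/esym/(periodize_box _ uK (M := `|t0| + 1)).
    have : `|t0 - t| < 1 by near: t; apply: (@cvgr_dist_lt _ _ _ _ _ id).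
    by have := ler_distD t0 t 0; rewrite !subr0 distrC; lra.
  apply: le_trans (ltW (truncnS_gt _)); rewrite le_max lexx orbT //.
rewrite /continuous_at -(nbhs_singleton vE).
have cv : continuous v.
  apply: continuous_sum => m _; apply: continuous_mul.
    apply: continuous_inv; first by move=> t; exact: expphase_neq0.
    exact: expphase_continuous.
  apply: continuous_compose cu; exact: translate_continuous.
apply: cvg_trans (cv t0).
exact: (@near_eq_cvg _ _ (nbhs t0) (nbhs_filter t0) _ _ vE).
Unshelve. all: by end_near. Qed.

Definition theta B (F : R3 -> C) := continuous F /\
  forall m t, F (t - lattice R m) = expphase B m t * F t.

(** Reindexing the series by [n + m] pulls out the factor of [n], since each factor is itself
    periodic in [t]. *)
Lemma theta_periodize B u :
  continuous u -> bounded_support u -> theta B (periodize B u).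
Proof.
move=> cu bu; split; first exact: periodize_continuous.
move=> n t; rewrite mulr_fsumr [RHS](reindex_fsbigT (fun m => n + m)).
  apply: eq_fsbigr => m _; rewrite expphase_lattice expphaseDl mulrA invfM.
  by rewrite mulrA mulfV ?expphase_neq0 // mul1r lattice_D opprD addrA.
by exists (fun m => m - n) => m; rewrite ?addrNK // addrC ?addKr ?addrNK // addrK.
Qed.

End Periodization.

(** * Isomorphisms, retracts and K_0 classes of modules *)

Section ModuleIsomorphisms.
Variable A : nzRingType.
Implicit Types M N : lmodType A.

Lemma linear_bundle M N (f : M -> N) : linear f ->
  exists g : {linear M -> N}, g =1 f.
Proof.
move=> lf; pose g : {linear M -> N} := HB.pack f (GRing.isLinear.Build _ _ _ _ f lf).
by exists g.
Qed.

Lemma fg_projective_retract M n (i : M -> 'rV[A]_n) (r : 'rV[A]_n -> M) :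
  linear i -> linear r -> cancel i r -> fg_projective M.
Proof.
move=> /linear_bundle[i' i'E] /linear_bundle[r' r'E] ir.
by exists n, i', r' => x; rewrite i'E r'E.
Qed.

Lemma fg_projective_iso M N : module_iso M N -> fg_projective N -> fg_projective M.
Proof.
move=> [f [g fK gK]] [n [i [r ir]]].
have lg : linear g.
  by move=> a u v; apply: (can_inj fK); rewrite linearP !gK.
apply: (@fg_projective_retract M n (i \o f) (g \o r)).
- by move=> a u v /=; rewrite !linearP.
- by move=> a u v /=; rewrite linearP lg.
- by move=> x /=; rewrite ir fK.
Qed.

Lemma K0_eq_iso M N : module_iso M N -> fg_projective N -> K0_eq M N.
Proof.
move=> MN pN; split => //; first exact: fg_projective_iso MN pN.
(* Any projective module can be the stabilising summand; [N] is at hand. *)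
exists N; split => //; case: MN => f [g fK gK].
pose h (x : M * N) : N * N := (f x.1, x.2).
have /linear_bundle[h' h'E] : linear h.
  by move=> a [u u'] [v v']; rewrite /h /= linearP.
exists h'; exists (fun y => (g y.1, y.2)) => -[x y] /=.
  by rewrite h'E /= fK.
by rewrite h'E /h /= gK.
Qed.

(** [f] restricts to a bijection of [U] onto [V]; its inverse is obtained by choice and is linear
    because [f] is linear and injective on [U]. *)
Lemma submodule_iso M N (U : submodule M) (V : submodule N) (f : M -> N) :
  linear f -> (forall x, submodule_set U x -> f x = 0 -> x = 0) ->
  (forall y, submodule_set V y <-> exists2 x, submodule_set U x & y = f x) ->
  module_iso (submodule_type V) (submodule_type U).
Proof.
move=> lf f0 Vf.
have Vfu (u : submodule_type U) : f (submodule_val u) \in submodule_pred V.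
  by apply/asboolP/Vf; exists (submodule_val u) => //; apply/asboolP/submodule_valP.
pose h u := SubmoduleType (Vfu u).
have lh : linear h by move=> a u v; apply: val_inj; rewrite /= lf.
have injh : injective h.
  move=> u v /(congr1 (@submodule_val _ _ V)) /= fuv; apply: val_inj => /=.
  apply/eqP; rewrite -subr_eq0; apply/eqP/f0.
    by apply/asboolP; exact: (submodule_valP (u - v)).
  have -> : submodule_val u - submodule_val v =
    (-1) *: submodule_val v + submodule_val u by rewrite scaleN1r addrC.
  by rewrite lf fuv scaleN1r addNr.
have surjh v : exists u, h u = v.
  have /asboolP/Vf[x Ux xv] := submodule_valP v.
  have xU : x \in submodule_pred U by apply/asboolP.
  by exists (SubmoduleType xU); apply: val_inj; rewrite /= -xv.
have [g hg] := choice surjh.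
have gh : cancel h g by move=> u; apply: injh; rewrite hg.
have /linear_bundle[g' g'E] : linear g.
  by move=> a u v; apply: injh; rewrite lh !hg.
by exists g', h => x; rewrite g'E.
Qed.

End ModuleIsomorphisms.

(** * Sums of line bundles and projectivity of their sections *)

Section DiagonalFactors.
Variable R : realType.
Local Notation C := (Cplx R).
Local Notation R3 := 'cV[R]_3.
Local Notation Z3 := 'cV[int]_3.

Lemma CT3P (f : R3 -> C) : continuous f ->
  (forall (p : Z3) t, f (t - lattice R p) = f t) ->
  exists a : CT3 R, forall t, a t = f t.
Proof.
move=> cf pf; have fT : f \in @torus_pred R by apply/asboolP; split.
by exists (MkCT3 fT).
Qed.

Lemma CT3_ext (a b : CT3 R) : (forall t, a t = b t) -> a = b.
Proof. by move=> ab; apply/val_inj/funext. Qed.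

Lemma CT3D (a b : CT3 R) t : (a + b) t = a t + b t.
Proof. by []. Qed.

Lemma CT3M (a b : CT3 R) t : (a * b) t = a t * b t.
Proof. by []. Qed.

Lemma CT3_sum (I : Type) (r : seq I) (F : I -> CT3 R) t :
  (\sum_(i <- r) F i) t = \sum_(i <- r) F i t.
Proof. by elim/big_rec2: _ => // i y1 y2 _ <-. Qed.

Section DiagFactor.
Variables (q : nat) (Bs : 'I_q -> 'M[int]_3).

Definition diag_fun (m : Z3) (t : R3) : 'M[C]_q :=
  diag_mx (\row_k expphase (Bs k) m t).

Fact diag_fun_continuous m i j : continuous (fun t => diag_fun m t i j).
Proof.
rewrite (_ : (fun t => _) = fun t => expphase (Bs i) m t *+ (i == j)).
  case: eqP => _; first exact: expphase_continuous.
  exact: continuous_const.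
by apply/funext => t; rewrite !mxE; case: eqP => [->|].
Qed.

Fact diag_fun_unit m t : diag_fun m t \in unitmx.
Proof.
rewrite unitmxE det_diag unitfE prodf_seq_neq0; apply/allP => k _.
by rewrite mxE expphase_neq0.
Qed.

Fact diag_fun_cocycle m n t :
  diag_fun (m + n) t = diag_fun m (t - lattice R n) *m diag_fun n t.
Proof.
rewrite mulmx_diag; congr diag_mx; apply/rowP => k.
by rewrite !mxE expphase_lattice expphaseDl.
Qed.

Definition diag_factor : automorphy_factor R q :=
  AutomorphyFactor diag_fun_continuous diag_fun_unit diag_fun_cocycle.

Lemma sections_diagP (F : R3 -> 'cV[C]_q) :
  submodule_set (sections diag_factor) F <->
  forall k, theta (Bs k) (fun t => F t k 0).
Proof.
split=> [[cF eF] k|tF].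
  split=> [|m t]; first exact: cF.
  by rewrite eF /= mul_diag_mx !mxE.
split=> [k|m t]; first by case: (tF k).
apply/matrixP => k j; rewrite (ord1 j) /= mul_diag_mx !mxE.
by case: (tF k).
Qed.

End DiagFactor.

(** Rounding to the nearest half-integer. Applied to each coordinate, it finds a tent of
    [theta_frame] that is nonzero at a given point. *)
Lemma quarter_grid (x : R) : exists bm : bool * int,
  `|x - bm.2%:~R - bm.1%:R / 2| <= 1 / 4.
Proof.
have := floor_le_tmp x; have := floorD1_gt x.
set n := Num.floor x => x1 x2.
move: x1; rewrite intrD => x1.
case: (lerP (x - n%:~R) (1 / 4)) => h1.
  by exists (false, n); rewrite /= mul0r subr0 ler_norml; apply/andP; split; lra.
case: (lerP (x - n%:~R) (3 / 4)) => h2.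
  by exists (true, n); rewrite /= ler_norml; apply/andP; split; lra.
exists (false, n + 1); rewrite /= mul0r subr0 intrD ler_norml.
by apply/andP; split; lra.
Qed.

Definition hat (r x : R) : R := Num.max 0 (r - `|x|).

Lemma hat_continuous r : continuous (hat r).
Proof.
move=> x; apply: (@continuous_max _ _ (cst 0) (fun x => r - `|x|) x).
  exact: cst_continuous.
apply: (@continuousB _ _ _ (cst r) (fun x => `|x|) x).
  exact: cst_continuous.
exact: norm_continuous.
Qed.

Lemma hat_eq0 r x : (hat r x == 0) = (r <= `|x|).
Proof.
rewrite /hat; case: lerP => h; first by rewrite max_l ?subr_le0 // eqxx.
by rewrite max_r ?gt_eqF // ?subr_gt0 // subr_ge0 ltW.
Qed.

Definition tent (w : 'I_3 -> R) (t : R3) : C := rc (\prod_i hat (w i) (t i 0)).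

Lemma tent_continuous w : continuous (tent w).
Proof.
apply: continuous_compose; last exact: rc_continuous.
apply: continuous_prod => i _; apply: continuous_compose; last exact: hat_continuous.
exact: coord_continuous.
Qed.

Lemma tent_eq0P w (t : R3) : reflect (exists i, w i <= `|t i 0|) (tent w t == 0).
Proof.
rewrite rc_eq0 prodf_seq_eq0; apply: (iffP hasP) => -[k].
  by move=> _; rewrite /= hat_eq0 => wk; exists k.
by move=> wk; exists k; rewrite ?mem_index_enum //= hat_eq0.
Qed.

Lemma tent_neq0P w (t : R3) : reflect (forall i, `|t i 0| < w i) (tent w t != 0).
Proof.
apply: (iffP idP) => [b0 i|tw].
  by rewrite ltNge; apply: contra b0 => wi; apply/tent_eq0P; exists i.
by apply/tent_eq0P => -[k]; rewrite leNgt tw.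
Qed.

Lemma tent_bounded_support w : bounded_support (tent w).
Proof.
exists (\sum_i `|w i|) => t wt; apply/eqP; apply: contraLR wt => /tent_neq0P wt.
rewrite -leNgt norm_le_coord ?sumr_ge0 // => i.
rewrite (bigD1 i) //= (le_trans (ltW (wt i))) //.
by rewrite (le_trans (ler_norm _)) // lerDl sumr_ge0.
Qed.

(** Representatives of the eight classes of the half-lattice modulo Z^3. *)
Definition half_shift (al : {ffun 'I_3 -> bool}) : R3 := \col_i ((al i)%:R / 2).

(* Radius 1/2 makes the tents at the half-lattice points overlap enough for these
   sections to have no common zero, while two lattice translates of one tent do
   not overlap. *)
Definition theta_frame (B : 'M[int]_3) (al : {ffun 'I_3 -> bool}) : R3 -> C :=
  periodize B (fun t => tent (fun=> 1 / 2) (t - half_shift al)).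

Lemma theta_frame_theta B al : theta B (theta_frame B al).
Proof.
apply: theta_periodize.
  apply: continuous_compose; last exact: tent_continuous.
  move=> t; apply: (@continuousB _ _ _ (fun t => t) (fun=> half_shift al) t).
    exact: cvg_id.
  exact: cst_continuous.
have [K bK] := tent_bounded_support (fun=> 1 / 2 : R).
exists (K + `|half_shift al|) => t Kt; apply: bK.
by apply: lt_le_trans (lerB_dist _ _); rewrite ltrBrDr.
Qed.

(** Take the half-lattice point nearest to [t], at distance at most 1/4 in each coordinate. Any
    other translate of the same tent is centred at least 3/4 away in some coordinate, so a single
    term of the series survives and nothing can cancel it. *)
Lemma theta_frame_neq0 B t : exists al, theta_frame B al t != 0.
Proof.
have [h hP] := choice (fun i : 'I_3 => quarter_grid (t i 0)).
pose al := [ffun i => (h i).1]; pose m : Z3 := \col_i (h i).2.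
exists al; rewrite /theta_frame /periodize -(fsbig_widen [set m]) //; last first.
  move=> n [_ /= nm]; apply/eqP; rewrite mulf_eq0; apply/orP; right.
  apply/tent_eq0P.
  have [i nmi] : exists i, n i 0 != m i 0.
    apply: contrapT => /forallNP nE; apply: nm; apply/matrixP => i j.
    by rewrite (ord1 j); apply/eqP/negP => /negP/nE.
  exists i; have := hP i; rewrite !mxE !ffunE.
  have : 1 <= `|(n i 0 - (h i).2)%:~R| :> R.
    rewrite -intr_norm ler1z; move: nmi; rewrite mxE; lia.
  rewrite intrB; set a := t i 0; set b := _%:~R; set c := _%:~R.
  set e := _ / 2; rewrite !ler_norml !ler_normr => h1 /andP[h2 h3].
  by apply/orP; case/orP: h1 => h1; [right|left]; lra.
rewrite fsbig_set1 mulf_neq0 ?invr_eq0 ?expphase_neq0 //.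
apply/tent_neq0P => i; rewrite !mxE ffunE.
by apply: le_lt_trans (hP i) _; lra.
Qed.

(** The factor has modulus one, so conjugation inverts it and the two factors cancel. *)
Lemma theta_conj_periodic B F G : theta B F -> theta B G ->
  exists a : CT3 R, forall t, a t = (G t)^* * F t.
Proof.
move=> [cF eF] [cG eG]; apply: CT3P.
  apply: continuous_mul cF; apply: continuous_compose cG _.
  exact: conjC_continuous.
move=> p t; rewrite eF eG rmorphM /= [X in X * _ * _]conjC_e.
rewrite mulrACA mulVf ?mul1r //; exact: expphase_neq0.
Qed.

Lemma theta_scale B (a : CT3 R) F : theta B F -> theta B (fun t => a t * F t).
Proof.
have /asboolP[ca pa] := CT3_valP a.
move=> [cF eF]; split; first exact: (continuous_mul ca cF).
by move=> m t; rewrite pa eF mulrCA.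
Qed.

Lemma theta_sum B (I : Type) (r : seq I) (F : I -> R3 -> C) :
  (forall i, theta B (F i)) -> theta B (fun t => \sum_(i <- r) F i t).
Proof.
move=> tF; split=> [|m t]; first by apply: continuous_sum => i _; case: (tF i).
by rewrite mulr_sumr; apply: eq_bigr => i _; case: (tF i).
Qed.

Section FiniteGeneration.
Variables (q : nat) (Bs : 'I_q -> 'M[int]_3).
Local Notation I := ('I_q * {ffun 'I_3 -> bool})%type.
Local Notation M := (submodule_type (sections (diag_factor Bs))).
Local Notation s k al := (theta_frame (Bs k) al).

Definition frame_square (k : 'I_q) t : C := \sum_al (s k al t)^* * s k al t.

Lemma frame_square_neq0 k t : frame_square k t != 0.
Proof.
have [al0 s0] := theta_frame_neq0 (Bs k) t.
have sq_ge0 al : 0 <= (s k al t)^* * s k al t by rewrite mulrC mul_conjC_ge0.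
apply: contra s0; rewrite psumr_eq0 // => /allP /(_ al0 (mem_index_enum _)) /=.
by rewrite mulrC mul_conjC_eq0.
Qed.

(** These are the coefficients of a section in the frame: pairing with a frame element gives a
    periodic function, and division by [frame_square] normalises the expansion. *)
Lemma frame_coordinates : exists c : I -> M -> CT3 R,
  forall i x t, c i x t =
    (s i.1 i.2 t)^* * (submodule_val x t i.1 0 / frame_square i.1 t).
Proof.
suff h (i : I) (x : M) : exists a : CT3 R, forall t, a t =
    (s i.1 i.2 t)^* * (submodule_val x t i.1 0 / frame_square i.1 t).
  have [c cP] := choice (fun ix : I * M => h ix.1 ix.2).
  by exists (fun i x => c (i, x)) => i x; exact: (cP (i, x)).
have /asboolP/sections_diagP xt := submodule_valP x.
have [f fE] := theta_conj_periodic (xt i.1) (theta_frame_theta (Bs i.1) i.2).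
have [n nP] : exists n : CT3 R, forall t, n t = (frame_square i.1 t)^-1.
  have [a aE] := choice (fun al => theta_conj_periodic
     (theta_frame_theta (Bs i.1) al) (theta_frame_theta (Bs i.1) al)).
  pose b := \sum_al a al.
  have bE t : b t = frame_square i.1 t.
    by rewrite /b CT3_sum; apply: eq_bigr => al _; rewrite aE.
  have /asboolP[cb pb] := CT3_valP b.
  apply: CT3P => [|p t]; last by rewrite -!bE pb.
  rewrite (_ : (fun t => _) = fun t => (b t)^-1).
    by apply: continuous_inv cb => t; rewrite bE frame_square_neq0.
  by apply/funext => t; rewrite bE.
by exists (f * n) => t; rewrite CT3M fE nP mulrA.
Qed.

(** The module is a retract of a free module of rank [8 q]: taking frame coefficients and
    recombining is the identity, because the products of frame elements with their conjugates sum to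
    [frame_square]. *)
Lemma fg_projective_sections : fg_projective M.
Proof.
have [c cP] := frame_coordinates.
pose i (x : M) : 'rV[CT3 R]_#|{: I}| := \row_j c (enum_val j) x.
pose r0 (a : 'rV[CT3 R]_#|{: I}|) : funmod 'cV[C]_q := fun t =>
  \col_k \sum_al a 0 (enum_rank (k, al)) t * s k al t.
have r0P a : r0 a \in submodule_pred (sections (diag_factor Bs)).
  apply/asboolP/sections_diagP => k.
  rewrite (_ : (fun t => _) =
    fun t => \sum_al (a 0 (enum_rank (k, al)) t * s k al t)).
    apply: theta_sum => al; apply: theta_scale; exact: theta_frame_theta.
  by apply/funext => t; rewrite mxE.
pose r a : M := SubmoduleType (r0P a).
apply: (@fg_projective_retract _ M _ i r).
- move=> a x y; apply/rowP => j; rewrite !mxE; apply: CT3_ext => t.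
  rewrite CT3D CT3M !cP /= mxE mxE.
  by rewrite mulrDl mulrDr; congr (_ + _); rewrite -!mulrA mulrCA.
- move=> a u v; apply: val_inj; apply/funext => t; apply/matrixP => k j.
  rewrite (ord1 j) /= !mxE mulr_sumr -big_split /=; apply: eq_bigr => al _.
  by rewrite !mxE CT3D CT3M mulrDl mulrA.
- move=> x; apply: val_inj; apply/funext => t; apply/matrixP => k j.
  rewrite (ord1 j) /= mxE.
  under eq_bigr => al _ do rewrite mxE enum_rankK cP /= mulrAC.
  by rewrite -mulr_suml mulrC divfK // frame_square_neq0.
Qed.

End FiniteGeneration.

End DiagonalFactors.

(** * Embedding the sections into compactly supported functions *)

Section ScalingModule.
Variables (R : realType) (q : nat) (Bs : 'I_q -> 'M[int]_3).
Hypothesis q_gt0 : (0 < q)%N.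
Hypothesis Bs_row0 : forall k j, Bs k 0 j = 0.
Local Notation C := (Cplx R).
Local Notation R3 := 'cV[R]_3.
Local Notation Z3 := 'cV[int]_3.

Definition width (i : 'I_3) : R := if i == 0 then q%:R else 1.

Lemma width_gt0 i : 0 < width i.
Proof. by rewrite /width; case: ifP; rewrite ?ltr0n. Qed.

Definition window : R3 -> C := tent (fun i => 2 / 3 * width i).

Definition wave (k : 'I_q) (x : R) : C := e_ (k%:R * x / q%:R).

Lemma waveD k x y : wave k (x + y) = wave k x * wave k y.
Proof. by rewrite /wave mulrDr mulrDl e_D. Qed.

Lemma waveN k x : wave k (- x) = (wave k x)^-1.
Proof. by rewrite /wave mulrN mulNr e_N. Qed.

(** This symmetry lets [sum_wave], a sum over frequencies, be used for sums over translates. *)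
Lemma waveC (k j : 'I_q) : wave k j%:R = wave j k%:R.
Proof. by rewrite /wave [k%:R * _]mulrC. Qed.

Lemma wave_neq0 k x : wave k x != 0.
Proof. exact: e_neq0. Qed.

Lemma wave_continuous k : continuous (wave k).
Proof.
apply: continuous_compose; last exact: e_continuous.
apply: continuous_mul; last exact: continuous_const.
by apply: continuous_mul; [exact: continuous_const | move=> x; exact: cvg_id].
Qed.

Lemma sum_wave (r : int) : (`|r| < q)%N ->
  \sum_k wave k r%:~R = if r == 0 then q%:R else 0.
Proof.
move=> rq; case: eqP => [->|/eqP r0].
  rewrite (eq_bigr (fun=> 1)) => [|k _]; last by rewrite /wave mulr0 mul0r e_0.
  by rewrite sumr_const card_ord.
rewrite -[RHS](sum_e_eq0 R r0 rq); apply: eq_bigr => k _.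
by rewrite /wave intrM -pmulrn [k%:R * _]mulrC.
Qed.

(** Only row 0 of [Bs k] enters for a multiple of [e_1], and that row is zero. *)
Lemma expphase_first k (m : Z3) (t : R3) :
  (forall i, i != 0 -> m i 0 = 0) -> expphase (Bs k) m t = 1 :> C.
Proof.
move=> m0; rewrite /expphase /phase (_ : m^T *m Bs k = 0).
  by rewrite map_mx0 mul0mx mxE e_0.
apply/rowP => j; rewrite !mxE big1 // => i _; rewrite mxE.
by case: (eqVneq i 0) => [->|/m0 ->]; rewrite ?Bs_row0 ?mulr0 ?mul0r.
Qed.

Definition synthesis (F : funmod 'cV[C]_q) : scalar_functions R :=
  fun t => window t * \sum_k wave k (t 0 0) * F t k 0.

Lemma synthesis_linear : linear synthesis.
Proof.
move=> a F G; apply/funext => t.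
rewrite -[RHS]/(a t * synthesis F t + synthesis G t) /synthesis.
rewrite [a t * _]mulrCA -mulrDr; congr (_ * _).
rewrite mulr_sumr -big_split /=.
by apply: eq_bigr => k _; rewrite !mxE mulrDr mulrCA.
Qed.

Lemma synthesis0 : synthesis 0 = 0.
Proof.
by have := synthesis_linear (-1) 0 0; rewrite scaleN1r oppr0 addr0 scaleN1r addNr.
Qed.

(* The sections are recovered from the values of the window's q interior points
   of t + Z^3 by Fourier inversion on Z/q. *)
Lemma synthesis_inj F : submodule_set (sections (diag_factor R Bs)) F ->
  synthesis F = 0 -> F = 0.
Proof.
move=> /sections_diagP tF F0; apply/funext => t; apply/matrixP => k' j0.
rewrite (ord1 j0) [RHS]mxE {j0}.
(* After this shift [s] lies in [[-q/2, -q/2 + 1)] along [e_1] and in [[-1/2, 1/2)] otherwise, so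
   [s + j e_1] stays inside the window for all [j < q]. *)
pose n : Z3 := \col_i (if i == 0 then Num.floor (t 0 0 + q%:R / 2)
                       else Num.floor (t i 0 + 1 / 2)).
pose s := t - lattice R n.
suff s0 : F s k' 0 = 0.
  case: (tF k') => _ /(_ n t); rewrite -/s s0 => /esym/eqP.
  by rewrite mulf_eq0 (negbTE (expphase_neq0 _ _ _)) => /eqP.
(* Evaluate [synthesis F = 0] at [s + j e_1], where the window is nonzero and [F] has the same value
   as at [s]. *)
have Gs (j : 'I_q) : \sum_k wave k (s 0 0) * F s k 0 * wave k j%:R = 0.
  pose m : Z3 := - (j%:Z *: delta_mx 0 0).
  have mE i : m i 0 = if i == 0 then - (j%:Z) else 0.
    by rewrite !mxE eqxx andbT; case: (i == 0); rewrite ?mulr1 ?mulr0 ?oppr0.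
  have sE i : (s - lattice R m) i 0 = s i 0 + (if i == 0 then j%:R else 0).
    have -> : (s - lattice R m) i 0 = s i 0 - (m i 0)%:~R.
      exact: translate_coord.
    rewrite mE; case: eqP => _; last by rewrite subr0 addr0.
    by rewrite intrN opprK -pmulrn.
  have wn0 : window (s - lattice R m) != 0.
    apply/tent_neq0P => i; rewrite sE /width.
    have -> : s i 0 = t i 0 - (n i 0)%:~R.
      exact: translate_coord.
    rewrite mxE.
    have jq : (j%:R : R) <= q%:R - 1 by rewrite lerBrDr natr1 ler_nat.
    have j0 : 0 <= j%:R :> R by [].
    case: eqP => [->|_].
      have := floor_le_tmp (t 0 0 + q%:R / 2); have := floorD1_gt (t 0 0 + q%:R / 2).
      by rewrite intrD ltr_norml => h1 h2; apply/andP; split; lra.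
    have := floor_le_tmp (t i 0 + 1 / 2); have := floorD1_gt (t i 0 + 1 / 2).
    by rewrite intrD ltr_norml => h1 h2; apply/andP; split; lra.
  have := congr1 (fun f : scalar_functions R => f (s - lattice R m)) F0.
  move/eqP; rewrite mulf_eq0 (negbTE wn0) /= => /eqP.
  rewrite sE eqxx => G0; rewrite -[RHS]G0; apply: eq_bigr => k _.
  have [_ /(_ m s) ->] := tF k; rewrite expphase_first => [|i /negbTE i0]; last first.
    by rewrite mE i0.
  by rewrite mul1r waveD mulrAC.
(* Summing over [j] against the inverse wave of [k'] isolates the component [k'], multiplied by
   [q]. *)
have : \sum_(j < q) (\sum_k wave k (s 0 0) * F s k 0 * wave k j%:R) *
   wave j (- k'%:R) = 0 by rewrite big1 // => j _; rewrite Gs mul0r.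
under eq_bigr do rewrite mulr_suml.
rewrite exchange_big (bigD1 k') //= [X in _ + X]big1 => [|k kk'].
  rewrite addr0 (eq_bigr (fun j => wave k' (s 0 0) * F s k' 0)) => [|j _].
    rewrite sumr_const card_ord => /eqP.
    rewrite mulrn_eq0 -[(q == 0)%N]negbK -lt0n q_gt0 /=.
    by rewrite mulf_eq0 (negbTE (wave_neq0 _ _)) => /eqP.
  by rewrite waveN waveC mulfK // wave_neq0.
rewrite (eq_bigr (fun j => wave k (s 0 0) * F s k 0 * wave j (k%:Z - k'%:Z)%:~R)).
  rewrite -mulr_sumr sum_wave ?ifF ?mulr0 //.
    by apply/negP => /eqP; move: kk'; rewrite -val_eqE /=; lia.
  by have := ltn_ord k; have := ltn_ord k'; lia.
move=> j _; by rewrite intrB waveD -!pmulrn waveC mulrA.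
Qed.

Definition inbox (r : R) (t : R3) := forall i, `|t i 0| <= r * width i.

(** Agrees with [window] on [inbox (1 / 3)] but vanishes nowhere, so that dividing by it preserves
    continuity on all of R^3. *)
Definition wide_window (t : R3) : C :=
  rc (\prod_i (width i / 3 + hat (width i / 3) (t i 0))).

Lemma wide_window_continuous : continuous wide_window.
Proof.
apply: continuous_compose; last exact: rc_continuous.
apply: continuous_prod => i _; apply: continuous_add.
  exact: continuous_const.
apply: continuous_compose; last exact: hat_continuous.
exact: coord_continuous.
Qed.

Lemma wide_window_neq0 t : wide_window t != 0.
Proof.
rewrite rc_eq0 prodf_seq_neq0; apply/allP => i _ /=; rewrite gt_eqF //.
rewrite ltr_pwDl ?divr_gt0 ?width_gt0 //.
by rewrite le_max lexx.
Qed.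

Lemma wide_windowE t : inbox (1 / 3) t -> wide_window t = window t.
Proof.
move=> tb; congr rc; apply: eq_bigr => i _; have := tb i; have := width_gt0 i.
by rewrite /hat => w0 ti; rewrite !max_r; lra.
Qed.

(* On the window, averaging f against the waves over Z^3 returns f: a translate
   of f by m <> 0 meets the window only if |m_i| < w_i for all i, so m is a
   multiple of e_1 that is not divisible by q, and its contribution cancels by
   orthogonality because the bundle is trivial along e_1. *)
Lemma synthesis_onto (f : R3 -> C) : continuous f ->
  (forall t, f t != 0 -> inbox (1 / 3) t) ->
  exists2 F, submodule_set (sections (diag_factor R Bs)) F & f = synthesis F.
Proof.
move=> cf fb.
(* Each component receives a [q]-th of [f / wide_window], with the wave that [synthesis] will attach
   divided out. *)
pose u k (t : R3) : C := q%:R^-1 * wave k (- t 0 0) * (f t / wide_window t).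
have uc k : continuous (u k).
  apply: continuous_mul; last first.
    apply: (continuous_mul cf); apply: continuous_inv wide_window_continuous.
    exact: wide_window_neq0.
  apply: continuous_mul; first exact: continuous_const.
  apply: continuous_compose; last exact: wave_continuous.
  move=> t; apply: (@continuousN _ _ _ (fun t : R3 => t 0 0) t).
  exact: coord_continuous.
pose K : R := \sum_i width i.
have u0 k t : f t = 0 -> u k t = 0 by move=> f0; rewrite /u f0 mul0r mulr0.
have uK k t : K < `|t| -> u k t = 0.
  move=> Kt; apply: u0; apply/eqP; apply: contraLR Kt => /fb tb.
  rewrite -leNgt norm_le_coord ?sumr_ge0 // => [i _|i]; first exact/ltW/width_gt0.
  rewrite (le_trans (tb i)) // /K (bigD1 i) //=.
  have : 0 <= \sum_(j | j != i) width j by apply: sumr_ge0 => j _; exact/ltW/width_gt0.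
  by have := width_gt0 i; lra.
pose F : funmod 'cV[C]_q := fun t => \col_k periodize (Bs k) (u k) t.
exists F.
  apply/sections_diagP => k.
  rewrite (_ : (fun t => _) = periodize (Bs k) (u k)).
    by apply: theta_periodize; [exact: uc | exists K; exact: uK].
  by apply/funext => t; rewrite mxE.
apply/funext => t; rewrite /synthesis.
have [w0|wn0] := eqVneq (window t) 0.
  rewrite w0 mul0r; apply/eqP; move/eqP: w0; apply: contraLR => /fb tb.
  apply/tent_neq0P => i; apply: le_lt_trans (tb i) _.
  by have := width_gt0 i; lra.
pose n := (Num.truncn (`|t| + K)).+1.
have nP : `|t| + K <= n%:R by exact/ltW/truncnS_gt.
under eq_bigr => k _ do rewrite mxE (periodize_box _ (uK k) (lexx _) nP) mulr_sumr.
have S0 : 0 \in fset_set (Zbox n).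
  by rewrite in_fset_set; [apply/mem_set => i; rewrite mxE | exact: finite_Zbox].
(* The term [m = 0] consists of [q] equal summands and gives [f t / wide_window t]; the others sum
   to zero. *)
rewrite exchange_big (big_fsetD1 _ S0) /= [X in _ + X]big1_seq => [|m].
  rewrite addr0 (eq_bigr (fun=> q%:R^-1 * (f t / wide_window t))) => [|k _].
    rewrite sumr_const card_ord -mulrnAl -mulr_natr mulVf ?mul1r; last first.
      by rewrite pnatr_eq0 -lt0n.
    have [->|/fb tb] := eqVneq (f t) 0; first by rewrite mul0r mulr0.
    by rewrite wide_windowE // mulrC divfK.
  rewrite /u lattice_0 subr0 expphase_first ?invr1 ?mul1r => [|i _]; last by rewrite mxE.
  by rewrite waveN [q%:R^-1 * _]mulrC -mulrA mulVKf // wave_neq0.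
rewrite in_fsetD1 => /andP[_ /andP[m0 _]].
set s := t - lattice R m.
have [f0|/fb sb] := eqVneq (f s) 0.
  by rewrite big1 // => k _; rewrite u0 ?mulr0.
(* The window bounds [|t_i|] strictly by 2/3 of the width, and the support of [f] bounds
   [|t_i - m_i|] by 1/3 of it. *)
have mw i : `|(m i 0)%:~R| < width i.
  have := sb i; have /tent_neq0P /(_ i) := wn0.
  have -> : s i 0 = t i 0 - (m i 0)%:~R by exact: translate_coord.
  by rewrite !ltr_norml !ler_norml => /andP[h1 h2] /andP[h3 h4]; apply/andP; split; lra.
have mi i : i != 0 -> m i 0 = 0.
  move=> /negbTE i0; have := mw i; rewrite /width i0 -intr_norm ltrz1; lia.
have m00 : m 0 0 != 0.
  apply: contra m0 => /eqP m00; apply/eqP/matrixP => i j; rewrite (ord1 j) mxE.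
  by case: (eqVneq i 0) => [->//|/mi].
have mq : (`|m 0%R 0%R| < q)%N.
  by have := mw 0; rewrite /width eqxx -intr_norm -abszE -pmulrn ltr_nat.
pose X := q%:R^-1 * (f s / wide_window s).
rewrite (eq_bigr (fun k => wave k (m 0 0)%:~R * X)) => [|k _].
  by rewrite -mulr_suml sum_wave // (negbTE m00) mul0r.
rewrite expphase_first // invr1 mul1r /u /X.
have -> : - s 0 0 = (m 0 0)%:~R - t 0 0.
  by rewrite translate_coord opprB.
rewrite waveD waveN; have := wave_neq0 k (t 0 0).
move: (wave k (m 0 0)%:~R) (wave k (t 0 0)) (f s / wide_window s) => b a Y a0.
move: (q%:R^-1) => c.
by field.
Qed.

End ScalingModule.

(** * The image of the embedding as a submodule *)

Section ScalingSubmodule.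
Variables (R : realType) (q : nat) (Bs : 'I_q -> 'M[int]_3).
Local Notation C := (Cplx R).
Local Notation R3 := 'cV[R]_3.

Definition scaling_set : set (scalar_functions R) :=
  [set f | exists2 F, submodule_set (sections (diag_factor R Bs)) F & f = synthesis F].

Fact scaling0 : scaling_set 0.
Proof.
by exists 0; [exact: submodule0 | rewrite synthesis0].
Qed.

Fact scalingD f g : scaling_set f -> scaling_set g -> scaling_set (f + g).
Proof.
move=> [F sF ->] [G sG ->]; exists (F + G); first exact: submoduleD.
by rewrite -[F]scale1r synthesis_linear !scale1r.
Qed.

Fact scalingZ (a : CT3 R) f : scaling_set f -> scaling_set (a *: f).
Proof.
move=> [F sF ->]; exists (a *: F); first exact: submoduleZ.
by rewrite -[a *: F]addr0 synthesis_linear synthesis0 addr0.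
Qed.

Definition scaling_module := Submodule scaling0 scalingD scalingZ.

Hypothesis q_gt0 : (0 < q)%N.
Hypothesis Bs_row0 : forall k j, Bs k 0 j = 0.

Lemma scaling_module_iso :
  module_iso (submodule_type scaling_module)
             (submodule_type (sections (diag_factor R Bs))).
Proof.
apply: (@submodule_iso _ _ _ _ _ (@synthesis R q)).
- exact: synthesis_linear.
- exact: synthesis_inj.
- by [].
Qed.

Lemma scaling_continuous f : scaling_set f -> continuous f.
Proof.
move=> [F /sections_diagP tF ->]; apply: continuous_mul; first exact: tent_continuous.
apply: continuous_sum => k _; apply: continuous_mul; last by case: (tF k).
apply: continuous_compose; last exact: wave_continuous.
exact: coord_continuous.
Qed.

Lemma scaling_inbox f t : scaling_set f -> f t != 0 -> inbox q (2 / 3) t.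
Proof.
move=> [F _ ->]; rewrite mulf_eq0 negb_or => /andP[/tent_neq0P wt _] i.
exact/ltW/wt.
Qed.

End ScalingSubmodule.

(** * The dilation operator, supports and membership in [Xi] *)

Section Dilations.
Variables (R : realType) (d : int) (q : nat).
Hypothesis d_gt1 : 1 < `|d|.
Hypothesis q_gt0 : (0 < q)%N.
Local Notation C := (Cplx R).
Local Notation R3 := 'cV[R]_3.
Local Notation D := (dilation (d%:M : 'M[int]_3) : (R3 -> C) -> (R3 -> C)).
Implicit Types (f g : R3 -> C) (V : set (R3 -> C)).

Let dR_neq0 : d%:~R != 0 :> R.
Proof. by rewrite intr_eq0; apply/eqP => d0; move: d_gt1; rewrite d0. Qed.

Let dR_ge2 : 2 <= `|d%:~R| :> R.
Proof.
have : 2%:~R <= (`|d|)%:~R :> R by rewrite ler_int; move: d_gt1; case: (`|d|).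
by rewrite intr_norm.
Qed.

Definition dilation_coef : C :=
  rc (Num.sqrt `|\det (map_mx intr (d%:M : 'M[int]_3) : 'M[R]_3)|)^-1.

Lemma dilation_coef_neq0 : dilation_coef != 0.
Proof.
rewrite rc_eq0 invr_eq0 map_scalar_mx det_scalar sqrtr_eq0 -ltNge normr_gt0.
by rewrite expf_neq0.
Qed.

Lemma dilationE f t : D f t = dilation_coef * f ((d%:~R)^-1 *: t).
Proof.
rewrite /dilation; congr (_ * f _).
by rewrite map_scalar_mx tr_scalar_mx invmx_scalar mul_scalar_mx.
Qed.

Definition dilation_inv f : R3 -> C := fun t => dilation_coef^-1 * f (d%:~R *: t).

Lemma dilationK : cancel D dilation_inv.
Proof.
move=> f; apply/funext => t; rewrite /dilation_inv dilationE scalerA mulVf //.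
by rewrite scale1r mulKf // dilation_coef_neq0.
Qed.

Lemma dilation_invK : cancel dilation_inv D.
Proof.
move=> f; apply/funext => t; rewrite dilationE /dilation_inv scalerA mulfV //.
by rewrite scale1r mulVKf // dilation_coef_neq0.
Qed.

Lemma scale_continuous (c : R) : continuous (fun t : R3 => c *: t).
Proof. exact: scaler_continuous. Qed.

Lemma dilation_continuous f : continuous f -> continuous (D f).
Proof.
move=> cf; rewrite (_ : D f = fun t => dilation_coef * f ((d%:~R)^-1 *: t)).
  apply: continuous_mul; first exact: continuous_const.
  exact: continuous_compose (@scale_continuous _) cf.
by apply/funext => t; rewrite dilationE.
Qed.

Lemma dilation_inv_continuous f : continuous f -> continuous (dilation_inv f).
Proof.
move=> cf; apply: continuous_mul; first exact: continuous_const.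
exact: continuous_compose (@scale_continuous _) cf.
Qed.

Definition supported (r : R) f := forall t, f t != 0 -> inbox q r t.

Lemma supported_dilation r f : supported r f -> supported (`|d%:~R| * r) (D f).
Proof.
move=> rf t; rewrite dilationE mulf_eq0 negb_or => /andP[_ /rf tb] i.
have := tb i; rewrite mxE normrM normfV mulrC ler_pdivrMr ?normr_gt0 //.
by rewrite mulrC mulrA.
Qed.

(** The exact ratio is [1 / |d|]; the bound 1/2 already carries the box of size 2/3 into the one of
    size 1/3. *)
Lemma supported_dilation_inv r f : 0 <= r -> supported r f ->
  supported (r / 2) (dilation_inv f).
Proof.
move=> r0 rf t; rewrite mulf_eq0 negb_or => /andP[_ /rf tb] i.
have := tb i; rewrite mxE normrM => h; have := width_gt0 R q_gt0 i => w0.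
have : 2 * `|t i 0| <= `|d%:~R| * `|t i 0| by rewrite ler_wpM2r.
lra.
Qed.

Lemma supported_iter r f n : 0 <= r -> supported r f ->
  supported (r / 2 ^+ n) (iter n dilation_inv f).
Proof.
move=> r0 rf; elim: n => [|n IH] /=; first by rewrite expr0 divr1.
rewrite exprSr invfM mulrA mulrC -mulrC; apply: supported_dilation_inv => //.
by rewrite divr_ge0 ?exprn_ge0.
Qed.

Lemma pow2_small (r e : R) : 0 < e -> exists n, r / 2 ^+ n <= e.
Proof.
move=> e0; pose n := (Num.truncn (`|r| / e)).+1; exists n.
have : `|r| / e < n%:R by exact: truncnS_gt.
rewrite ltr_pdivrMr // => rn.
have : n%:R < 2 ^+ n :> R by rewrite -natrX ltr_nat ltn_expl.
rewrite ler_pdivrMr ?exprn_gt0 // => n2.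
rewrite (le_trans (ler_norm _)) // (le_trans (ltW rn)) // mulrC.
by rewrite ler_wpM2l // ltW.
Qed.

Lemma iter_image V n f :
  iter n (fun W => D @` W) V f <-> V (iter n dilation_inv f).
Proof.
elim: n f => [//|n IH] f; rewrite iterS [in X in _ <-> X]iterSr.
split=> [[g /IH Vg <-]|/IH Vf]; first by rewrite dilationK.
by exists (dilation_inv f); rewrite ?dilation_invK.
Qed.

Lemma iter_preimage V n f :
  iter n (fun W => D @^-1` W) V f <-> V (iter n D f).
Proof.
elim: n f => [//|n IH] f; rewrite iterS [in X in _ <-> X]iterSr.
exact: IH.
Qed.

(** A product of segments: [rV_compact] treats row vectors, and transposition is continuous. *)
Lemma inbox_compact r : compact (inbox q r : set R3).
Proof.
pose I i := `[(- (r * width R q i)), (r * width R q i)]%classic.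
pose A := [set v : 'rV[R]_3 | forall i, I i (v ord0 i)].
have cA : compact A by apply: (@rV_compact R 3 I) => i; exact: segment_compact.
have -> : inbox q r = (fun v : 'rV[R]_3 => v^T) @` A.
  apply/seteqP; split => [t tb|_ [v vA <-] i] /=.
    exists t^T; rewrite ?trmxK // => i /=; rewrite mxE /I /= in_itv /= -ler_norml.
    exact: tb.
  by have := vA i; rewrite /I /= in_itv /= -ler_norml mxE.
apply: continuous_compact => //; apply: continuous_subspaceT => v.
move=> s /= /nbhs_ballP[e e0 es]; apply/nbhs_ballP; exists e => // w [_ vw].
by apply: es; split=> // i j; rewrite !mxE; exact: vw.
Qed.

Lemma Cc_supported r f : continuous f -> supported r f -> Cc f.
Proof.
move=> cf rf; split => //.
have hd : hausdorff_space R3 by exact: norm_hausdorff.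
apply: (@subclosed_compact _ _ (inbox q r)); first exact: closed_closure.
  exact: inbox_compact.
rewrite [X in _ `<=` X](iffLR (closure_id _)).
  by apply: closure_subset => t; exact: rf.
apply: compact_closed hd _; exact: inbox_compact.
Qed.

Lemma Cc_Xi f : Cc f -> Xi f.
Proof.
move=> cf; split=> [|e e0]; first by case: cf.
exists f => //; rewrite subrr /Xi_norm.
rewrite (_ : range _ = [set 0%E]) ?ereal_sup1 ?sqrte0 ?lte_fin //.
apply/seteqP; split=> [_ [t _ <-]|_ ->].
  rewrite /inner_diag /= esum1 // => p _; rewrite /sqabs /=.
  by rewrite expr0n /= addr0.
exists 0 => //; rewrite /inner_diag esum1 // => p _; rewrite /sqabs /=.
by rewrite expr0n /= addr0.
Qed.

End Dilations.

(** * The multiresolution axioms *)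

Section Multiresolution.
Variables (R : realType) (d : int) (q : nat).
Hypothesis d_gt1 : 1 < `|d|.
Hypothesis q_gt0 : (0 < q)%N.
Local Notation C := (Cplx R).
Local Notation R3 := 'cV[R]_3.
Local Notation A := (d%:M : 'M[int]_3).
Local Notation D := (dilation A : (R3 -> C) -> (R3 -> C)).
Local Notation Dinv := (@dilation_inv R d).
Implicit Types (f g : R3 -> C) (V W : set (R3 -> C)).

Lemma dilation_pow_ind V (P : set (R3 -> C) -> Prop) j :
  P V -> (forall W, P W -> P (D @` W)) -> (forall W, P W -> P (D @^-1` W)) ->
  P (dilation_pow A j V).
Proof.
move=> PV PD PDi; case: j => n; first by elim: n => //= n IH; exact: PD.
by rewrite /dilation_pow; elim: n.+1 => //= m IH; exact: PDi.
Qed.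

Lemma subspace_image W : Defs.subspace W -> Defs.subspace (D @` W).
Proof.
move=> [W0 WD WZ]; have D0 : D 0 = 0.
  by apply/funext => t; rewrite dilationE mulr0.
split=> [|_ _ [f Wf <-] [g Wg <-]|c _ [f Wf <-]].
- by exists 0.
- exists (f + g); first exact: WD.
  by apply/funext => t; rewrite -[RHS]/(D f t + D g t) !dilationE mulrDr.
- exists (fun t => c * f t); first exact: WZ.
  by apply/funext => t; rewrite !dilationE mulrCA.
Qed.

Lemma subspace_preimage W : Defs.subspace W -> Defs.subspace (D @^-1` W).
Proof.
move=> [W0 WD WZ]; have D0 : D 0 = 0.
  by apply/funext => t; rewrite dilationE mulr0.
split=> [|f g Wf Wg|c f Wf] /=.
- by rewrite D0.
- rewrite (_ : D (f + g) = D f + D g); first exact: WD.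
  by apply/funext => t; rewrite -[RHS]/(D f t + D g t) !dilationE mulrDr.
- rewrite (_ : D _ = fun t => c * D f t); first exact: WZ.
  by apply/funext => t; rewrite !dilationE mulrCA.
Qed.

Lemma submodule_subspace (V0 : submodule (scalar_functions R)) : Defs.subspace V0.
Proof.
split=> [|u v|c f Vf]; [exact: submodule0 | exact: (@submoduleD _ _ V0 u v) |].
have [a aE] : exists a : CT3 R, forall t, a t = c.
  by apply: CT3P => //; exact: continuous_const.
rewrite (_ : (fun t => _) = a *: (f : scalar_functions R)); first exact: submoduleZ.
by apply/funext => t; rewrite -[RHS]/(a t * f t) aE.
Qed.

(** A property stable under images and preimages by [D] and implying inclusion in [Xi], so it
    transfers from [V_0] to every [V_j]. *)
Definition tame W := forall f, W f ->
  continuous f /\ exists2 r : R, 0 <= r & supported q r f.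

Lemma tame_image W : tame W -> tame (D @` W).
Proof.
move=> tW _ [f /tW[cf [r r0 rf]] <-]; split; first exact: dilation_continuous.
by exists (`|d%:~R| * r); [rewrite mulr_ge0 | exact: supported_dilation].
Qed.

Lemma tame_preimage W : tame W -> tame (D @^-1` W).
Proof.
move=> tW f /tW[cf [r r0 rf]]; rewrite -(dilationK d_gt1 f).
split; first exact: dilation_inv_continuous.
by exists (r / 2); [rewrite divr_ge0 | exact: supported_dilation_inv].
Qed.

Lemma tame_Xi W : tame W -> W `<=` Xi (R := R).
Proof. by move=> tW f /tW[cf [r _ rf]]; apply/Cc_Xi/(Cc_supported cf rf). Qed.

Lemma Cc_bounded f : Cc f -> exists2 r : R, 0 <= r & supported q r f.
Proof.
move=> [cf /compact_bounded[M [_ bM]]].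
(* [compact_bounded] bounds the norm by any number above [M], and [M] may be negative; this choice
   is also nonnegative. *)
have M1 : M < `|M| + 1 by have := ler_norm M; lra.
exists (`|M| + 1) => [|t ft i]; first by have := normr_ge0 M; lra.
apply: le_trans (norm_coord t i) _.
have := bM _ M1 t (@subset_closure _ [set x | f x != 0] t ft) => tM; apply: le_trans tM _.
rewrite ler_peMr ?addr_ge0 // /width; case: ifP => // _.
by rewrite ler1n.
Qed.

(** The boxes shrink to the origin, so [f] vanishes elsewhere, and continuity then gives
    [f 0 = 0]. *)
Lemma supported_everywhere_small f : continuous f ->
  (forall n, supported q (2 / 3 / 2 ^+ n) f) -> f = 0.
Proof.
move=> cf fs.
have f0 t : t != 0 -> f t = 0.
  move=> t0; apply/eqP; apply: contraNT t0 => ft; apply/eqP/matrixP => i j.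
  rewrite (ord1 j) mxE; apply/eqP; rewrite -normr_le0 leNgt; apply/negP => ti.
  have w0 := width_gt0 R q_gt0 i.
  (* The [n]-th box has half-width at most [|t_i| / 2] along [i], hence excludes [t]. *)
  have [n nP] := pow2_small (2 / 3) (divr_gt0 ti (mulr_gt0 (ltr0n R 2) w0)).
  have := fs n t ft i; apply/negP; rewrite -ltNge.
  apply: le_lt_trans (ler_wpM2r (ltW w0) nP) _.
  rewrite invfM mulrA mulfVK ?gt_eqF //; lra.
apply/funext => t; have [->|/f0 //] := eqVneq t 0.
apply/eqP; apply: contrapT => /negP fn0.
(* If [f 0] were nonzero, [f] would be within less than [|f 0|] of it on a ball, which contains the
   nonzero point with all coordinates [e / 2], a zero of [f]. *)
have /cvgrPdist_lt /(_ `|f 0|) := cf 0.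
rewrite normr_gt0 => /(_ fn0) /nbhs_ballP[e /= e0 eb].
have /eb /= : ball (0 : R3) e (const_mx (e / 2)).
  by split=> // i j; rewrite /ball /= !mxE sub0r normrN gtr0_norm; lra.
rewrite (f0 (const_mx (e / 2))) ?subr0 ?ltxx //.
apply/eqP => /matrixP /(_ 0 0); rewrite !mxE; lra.
Qed.

(** [V0] is squeezed between the continuous functions supported in two boxes of ratio 2, and the
    inverse dilation shrinks boxes by at least that ratio. *)
Lemma PMRA_criterion (V0 : submodule (scalar_functions R)) :
  fg_projective (submodule_type V0) ->
  (forall f, submodule_set V0 f -> continuous f /\ supported q (2 / 3) f) ->
  (forall f, continuous f -> supported q (1 / 3) f -> submodule_set V0 f) ->
  (V0 : set _) `<=` D @` V0 /\ is_PMRA A (fun j => dilation_pow A j V0).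
Proof.
move=> pV0 V0s sV0.
have nest : (V0 : set _) `<=` D @` V0.
  move=> f /V0s[cf sf]; exists (Dinv f); last exact: dilation_invK.
  apply: sV0; first exact: dilation_inv_continuous.
  rewrite (_ : 1 / 3 = 2 / 3 / 2); last by field.
  by apply: supported_dilation_inv => //; lra.
have tV0 : tame V0 by move=> f /V0s[cf sf]; split => //; exists (2 / 3) => //; lra.
split=> //; split.
- move=> j; split.
    apply: tame_Xi; apply: dilation_pow_ind => //.
      exact: tame_image.
    exact: tame_preimage.
  apply: dilation_pow_ind.
  - exact: submodule_subspace.
  - exact: subspace_image.
  - exact: subspace_preimage.
- by exists V0.
- by [].
(* The case [j = -1] stands apart: there [dilation_pow] passes from preimages to images. *)
- case=> [n|[|n]].
  + rewrite -PoszD addn1 /=; elim: n => [|n IH] //=.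
    exact: image_subset.
  + by move=> f /= /nest[g Vg /(can_inj (dilationK d_gt1)) <-].
  + have -> : Negz n.+1 + 1 = Negz n by rewrite !NegzE; lia.
    rewrite /dilation_pow; elim: n.+1 => [|m IH].
      by move=> f /= /nest[g Vg /(can_inj (dilationK d_gt1)) <-].
    exact: preimage_subset.
(* The approximant in [Cc] supplied by [Xi] itself lies in some [V_n]: enough inverse dilations
   bring its support into the box of size 1/3. *)
- move=> xi [_ happ] eps eps0; have [eta Ceta hlt] := happ eps eps0.
  have [r r0 sr] := Cc_bounded Ceta.
  have [n nP] := pow2_small r (divr_gt0 (ltr01) (ltr0n R 3)).
  exists n, eta; split=> //; apply/(iter_image d_gt1).
  apply: sV0.
    elim: n {nP} => [|n IH]; first by case: Ceta.
    by rewrite iterS; exact: dilation_inv_continuous.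
  move=> t /(supported_iter d_gt1 q_gt0 r0 sr) tb i.
  by apply: le_trans (tb i) _; rewrite ler_wpM2r // ltW // width_gt0.
(* For [f] in the intersection, [D^n f] lies in [V0] for all [n]; undoing the dilations confines [f]
   to boxes of size [2 / 3 / 2^n]. *)
- apply/seteqP; split=> [f fV|_ -> j _]; last first.
    by have [] : Defs.subspace (dilation_pow A j V0);
      [apply: dilation_pow_ind; [exact: submodule_subspace | exact: subspace_image
       | exact: subspace_preimage] |].
  apply: supported_everywhere_small.
    by case: (V0s f (fV 0 I)).
  case=> [|n].
    by rewrite expr0 divr1; case: (V0s f (fV 0 I)).
  have /iter_preimage/V0s[_ sf] := fV (Negz n) I.
  have r0 : 0 <= 2 / 3 :> R by lra.
  have := supported_iter d_gt1 q_gt0 r0 sf (n := n.+1).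
  suff -> : iter n.+1 Dinv (iter n.+1 D f) = f by [].
  elim: n.+1 => [//|m IH].
  by rewrite (iterS m D) iterSr (dilationK d_gt1).
Qed.

End Multiresolution.

(** * Realising a prescribed first Chern class *)

Section ChernClass.
Variable R : realType.
Implicit Types B c : 'M[int]_3.

Lemma phase_unitZ B (i j : 'I_3) :
  phase B (unitZ i) (lattice R (unitZ j)) = (B i j)%:~R.
Proof.
rewrite /phase -map_mxM mxE; congr (_%:~R).
by rewrite trmx_delta -rowE -colE !mxE.
Qed.

Lemma phaseB B (m : 'cV[int]_3) (s t : 'cV[R]_3) :
  phase B m (s - t) = phase B m s - phase B m t.
Proof. by rewrite /phase mulmxBr !mxE. Qed.

Definition lower_part c : 'M[int]_3 := \matrix_(i, j) if (j < i)%N then c i j else 0.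

Definition chern_family (q : nat) c (k : 'I_q) : 'M[int]_3 :=
  if k == 0 :> nat then lower_part c else 0.

(** The choice of the lower, rather than upper, triangle makes the first row vanish, as the
    embedding requires. *)
Lemma chern_family_row0 q c (k : 'I_q) j : chern_family c k 0 j = 0.
Proof. by rewrite /chern_family; case: ifP => _; rewrite mxE. Qed.

(** Only the first summand contributes to the determinant, which is [e_] of its phase. With the
    phases as logarithms, translating [h_j] by [e_i] changes it by [- B_ji], so the coefficient is
    [B_ij - B_ji = c_ij]. *)
Lemma first_chern_class_diag q c : (0 < q)%N -> c^T = - c ->
  first_chern_class (diag_factor R (@chern_family q c)) c.
Proof.
move=> q0 cT; pose B := lower_part c.
have dE m t : \det (diag_factor R (@chern_family q c) m t) = e_ (phase B m t).
  rewrite det_diag (bigD1 (Ordinal q0)) //= mxE big1 ?mulr1 // => k k0.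
  by rewrite mxE /chern_family ifF ?expphase0 //; apply/negbTE.
exists (fun i t => phase B (unitZ i) t); split=> [i|i t|i j t].
- exact: phase_continuous.
- by rewrite dE sqabs_e sqrtr1 mul1r.
have subK (x a : R) : x - a - x = - a by rewrite addrAC subrr sub0r.
rewrite !phaseB !phase_unitZ !subK opprK addrC -intrB; congr (_%:~R); rewrite !mxE.
have cE : c i j = - c j i by move/matrixP/(_ j i): cT; rewrite !mxE.
(* On the diagonal, antisymmetry over the integers forces [c_ii = 0]. *)
by case: ltngtP => ij; rewrite ?subr0 ?sub0r //; move: cE; rewrite (val_inj ij); lia.
Qed.

End ChernClass.

Theorem theorem4p5 (R : realType) (d : int) (hd : 1 < `|d|)
    (q : nat) (hq : (0 < q)%N) (c1 c2 c3 : int)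
    (hpos : K0_positive R (ext_elt q c1 c2 c3)) :
  let A : 'M[int]_3 := d%:M in
  exists V0 : submodule (scalar_functions R),
    [/\ (V0 : set _) `<=` @Xi R,
        fg_projective (submodule_type V0),
        K0_class (submodule_type V0) (ext_elt q c1 c2 c3),
        (V0 : set _) `<=` dilation A @` V0
      & is_PMRA A (fun j => dilation_pow A j V0)].
Proof.
move=> A; pose c := (ext_elt q c1 c2 c3).2.
have cT : c^T = - c by apply/matrixP => i j; rewrite !mxE; lia.
pose V0 := scaling_module R (@chern_family q c).
have iso := scaling_module_iso R hq (@chern_family_row0 q c).
have pS := fg_projective_sections R (@chern_family q c).
have pV0 : fg_projective (submodule_type V0) := fg_projective_iso iso pS.
have [|f cf sf|nest pmra] := PMRA_criterion hd hq pV0.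
- move=> f Vf; split; first exact: scaling_continuous Vf.
  by move=> t; exact: scaling_inbox Vf.
- have [F sF fE] := synthesis_onto hq (@chern_family_row0 q c) cf sf.
  by exists F.
exists V0; split=> //.
- by case: (pmra_sub pmra 0).
exists q, (diag_factor R (@chern_family q c)); split.
  exact: K0_eq_iso iso pS.
by split=> //; exact: first_chern_class_diag.
Qed.
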